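(* Let $q \geq 4$ be a prime power and $k \geq 1$. Let $Y$ be an independent set of $qK_{2k:k}$ (i.e. a family of $k$-dimensional subspaces of $\mathbb{F}_q^{2k}$ any two of which intersect nontrivially). If $Y$ is not contained in a dictator or in the dual of a dictator, then \[ |Y| < 3 \begin{bmatrix} k \\ 1 \end{bmatrix} \begin{bmatrix} 2k-2 \\ k-2 \end{bmatrix}. \]
   Context: The $q$-Kneser graph $qK_{2k:k}$ has as vertices the $k$-dimensional subspaces of $\mathbb{F}_q^{2k}$, adjacent iff they intersect trivially. The Gaussian binomial coefficient is $\begin{bmatrix} n \\ m \end{bmatrix} = \prod_{i=1}^m \frac{q^{n-i+1}-1}{q^i-1}$ (and $0$ if $m<0$), the number of $m$-dimensional subspaces of $\mathbb{F}_q^n$. A dictator is the set of all $k$-subspaces containing a fixed $1$-dimensional subspace (point); the dual of a dictator is the set of all $k$-subspaces contained in a fixed $(2k-1)$-dimensional subspace (hyperplane). *)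

(* Defs.v *)
From HB Require Import structures.
From mathcomp Require Import all_boot all_order all_algebra.

Set Implicit Arguments.
Unset Strict Implicit.
Unset Printing Implicit Defensive.

Import Order.TTheory GRing.Theory Num.Theory.
Import VectorInternalTheory.
Local Open Scope ring_scope.

(* The library gives {vspace vT} only a choiceType structure; over a finite
   field it is finite, as a subtype of a type of square matrices. *)
HB.instance Definition _ (F : finFieldType) (vT : vectType F) :=
  [Countable of {vspace vT} by <:].
HB.instance Definition _ (F : finFieldType) (vT : vectType F) :=
  [Finite of {vspace vT} by <:].

Section QKneser.

Variables (F : finFieldType) (k : nat).

Definition qK_vertex := {U : {vspace 'rV[F]_(2 * k)} | \dim U == k}.

(* For k >= 1 this relation is irreflexive, so that the graph is simple. *)
Definition qK_adj : rel qK_vertex :=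
  fun U W => (val U :&: val W == 0)%VS.

Definition dictator (P : {vspace 'rV[F]_(2 * k)}) : {set qK_vertex} :=
  [set U : qK_vertex | (P <= val U)%VS].

Definition dual_dictator (H : {vspace 'rV[F]_(2 * k)}) : {set qK_vertex} :=
  [set U : qK_vertex | (val U <= H)%VS].

Definition is_dictator (D : {set qK_vertex}) : Prop :=
  exists2 P, \dim P = 1%N & D = dictator P.

Definition is_dual_dictator (D : {set qK_vertex}) : Prop :=
  exists2 H, \dim H = (2 * k - 1)%N & D = dual_dictator H.

End QKneser.

Definition independent (T : finType) (e : rel T) (Y : {set T}) : Prop :=
  forall x y, x \in Y -> y \in Y -> ~~ e x y.

(* Integer arguments, so that n - i + 1 is not truncated when i > n, and so
   that a negative m is distinguished from m = 0. *)
Definition gauss_binom (q : nat) (n m : int) : rat :=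
  match m with
  | Posz m' => \prod_(1 <= i < m'.+1)
                 ((q%:R ^ (n - i%:Z + 1) - 1) / (q%:R ^+ i - 1))
  | Negz _ => 0
  end.

(* Main.v *)
(* Double counting replaces spectral theory.  Let [N_j] be the number of
   k-spaces through a j-space, [t = (q^k - 1)/(q - 1)] and [B = t N_2], and
   suppose [|Y| >= 3B].  A point
   lying on more than [D = N_2 + t^2 N_3] members of [Y] would lie on two
   lines each meeting all of [Y], which forces [|Y| <= 2B]; by duality no
   hyperplane contains more than [D] members either.  Now let [v_P] be the
   degree of the point [P] minus the mean degree and [F(z)] the sum of the
   [v_P] over the points of the k-space [z].  Then [F >= -s] everywhere for
   [s] = [t] times the mean degree, and [F + s >= |Y|] on [Y], so that
   [sum_z F^2 (F + s) >= |Y| sum_Y F^2 >= (sum_P v_P^2)^2].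
   On the other hand [sum_z F^3] is a positive combination of the sums of cubes
   of the deviations of point degrees and of hyperplane degrees, all of which
   are at most [D] minus the mean degree; for [q >= 4] and [k >= 3] the two
   estimates are incompatible. *)
Require Import Defs.
From HB Require Import structures.
From mathcomp Require Import all_boot all_order all_algebra all_field.
From mathcomp Require Import ring lra zify.

Set Implicit Arguments.
Unset Strict Implicit.
Unset Printing Implicit Defensive.

Import Order.TTheory GRing.Theory Num.Theory.
Local Open Scope ring_scope.

(** * Counting points, covers and k-spaces in a finite vector space *)

Section SubspaceCounts.

Variables (F : finFieldType) (n : nat).
Local Notation vT := 'rV[F]_n.
Local Notation q := (#|F|%:R : rat).
Implicit Types (P Q T U W z : {vspace vT}).

Definition theta d : rat := (q ^+ d - 1) / (q - 1).

Lemma q_gt1 : 1 < q.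
Proof. by rewrite ltr1n finNzRing_gt1. Qed.

Lemma q_sub1_neq0 : q - 1 != 0.
Proof. by rewrite subr_eq0 gt_eqF ?q_gt1. Qed.

Lemma theta_ge0 d : 0 <= theta d.
Proof.
have q1 := q_gt1.
by rewrite divr_ge0 ?subr_ge0 ?exprn_ege1 // ltW.
Qed.

Lemma theta_gt0 d : (0 < d)%N -> 0 < theta d.
Proof.
have q1 := q_gt1; move=> d0.
by rewrite divr_gt0 ?subr_gt0 ?exprn_egt1 // -lt0n.
Qed.

Lemma card_nonzero U :
  \sum_(u : vT | (u != 0) && (u \in U)) 1 = q ^+ \dim U - 1.
Proof.
have cU : #|[pred u : vT | u \in U]| = (#|F| ^ \dim U)%N by apply: card_vspace.
rewrite -natrX -cU (cardD1 (0 : vT)) inE mem0v natrD addrAC subrr add0r.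
by rewrite -sum1_card natr_sum; apply: eq_bigl => u; rewrite !inE.
Qed.

(** Every nonzero vector of [U] spans one point, and each point is spanned by [q - 1] vectors. *)
Lemma count_points U :
  \sum_(P : {vspace vT} | (\dim P == 1%N) && (P <= U)%VS) 1 = theta (\dim U).
Proof.
have q1 := q_sub1_neq0.
apply: (mulIf q1); rewrite mulfVK //.
rewrite -card_nonzero big_distrl /=.
rewrite (partition_big (fun u : vT => <[u]>%VS)
     (fun P : {vspace vT} => (\dim P == 1%N) && (P <= U)%VS)) /=; last first.
  by move=> u /andP[u0 uU]; rewrite dim_vline u0 -memvE.
apply: eq_bigr => P /andP[/eqP dP PU]; rewrite mul1r.
have -> : q - 1 = \sum_(u : vT | (u != 0) && (u \in P)) 1.
  by rewrite card_nonzero dP expr1.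
apply: eq_bigl => u.
rewrite -andbA; case: (eqVneq u 0) => //= u0.
rewrite eqEdim dim_vline u0 dP /= andbT -memvE andb_idl //.
by move=> uP; apply: (subvP PU).
Qed.

Lemma theta_diff i d : (i <= d)%N -> theta d - theta i = q ^+ i * theta (d - i).
Proof.
move=> le_id; have q1 := q_sub1_neq0.
rewrite /theta -{1}(subnKC le_id) exprD; field.
exact: q1.
Qed.

Lemma theta1 : theta 1 = 1.
Proof. by rewrite /theta expr1 divff ?q_sub1_neq0. Qed.

Lemma dim_add_point T P :
  \dim P = 1%N -> ~~ (P <= T)%VS -> \dim (T + P)%VS = (\dim T).+1.
Proof.
move=> dP nPT; rewrite dimv_disjoint_sum ?dP ?addn1 //.
apply/eqP; rewrite -dimv_eq0 capvC.
have := dimv_leqif_eq (capvSl P T); rewrite dP => /leqifP.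
by case: eqP => [/capv_idPl|_]; [rewrite (negbTE nPT) | case: (\dim _)].
Qed.

(** The map [P |-> T + P] sends the points of [U] outside [T] onto these covers; each fibre consists
    of the [q ^+ \dim T] points of [W] outside [T]. *)
Lemma count_covers T U : (T <= U)%VS ->
  \sum_(W : {vspace vT} | [&& \dim W == (\dim T).+1, (T <= W)%VS & (W <= U)%VS]) 1
    = theta (\dim U - \dim T).
Proof.
move=> TU; have qj : q ^+ \dim T != 0 by rewrite expf_neq0 // gt_eqF // (lt_trans ltr01 q_gt1).
apply: (mulfI qj); rewrite -theta_diff ?dimvS // -!count_points.
rewrite [in RHS](bigID (fun P : {vspace vT} => (P <= T)%VS)) /= addrAC.
rewrite [X in _ = X - _ + _](eq_bigl (fun P => (\dim P == 1%N) && (P <= T)%VS)); last first.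
  by move=> P; rewrite -andbA; case: eqP => //= _; apply: andb_idl => /subv_trans; apply.
rewrite subrr add0r big_distrr /=.
rewrite [RHS](partition_big (fun P => (T + P)%VS)
   (fun W => [&& \dim W == (\dim T).+1, (T <= W)%VS & (W <= U)%VS])) /=; last first.
  move=> P /andP[/andP[/eqP dP PU] nPT].
  by rewrite dim_add_point // eqxx addvSl subv_add TU PU.
apply: eq_bigr => W /and3P[/eqP dW TW WU]; rewrite mulr1.
have -> : q ^+ \dim T = theta (\dim W) - theta (\dim T).
  by rewrite dW theta_diff // subSnn theta1 mulr1.
rewrite -!count_points [X in X - _](bigID (fun P : {vspace vT} => (P <= T)%VS)) /=.
rewrite [X in X + _ - _](eq_bigl (fun P => (\dim P == 1%N) && (P <= T)%VS)); last first.
  by move=> P; rewrite -andbA; case: eqP => //= _; apply: andb_idl => /subv_trans; apply.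
rewrite addrAC subrr add0r; apply: eq_bigl => P.
case: eqP => //= dP; case: (boolP (P <= T)%VS) => nPT; rewrite ?andbF //= !andbT.
apply/idP/andP => [PW|[PU /eqP <-]]; last exact: addvSr.
split; first exact: subv_trans WU.
by rewrite eqEdim subv_add TW PW dW dim_add_point ?leqnn.
Qed.

Definition above k T : {set {vspace vT}} := [set z | (\dim z == k) && (T <= z)%VS].

(** The Gaussian binomial in absorption form, which matches the induction of [card_above];
    [gauss_binom_gbin] links it to the product formula. *)
Fixpoint gbin N m : rat :=
  if m is m'.+1 then theta N / theta m * gbin N.-1 m' else 1.

(** Double count pairs [W <= z] with [W] covering [T]: each [z] contains [theta (k - \dim T)] such
    [W], and induction counts the [z] through each [W]. *)
Lemma card_above k T : (\dim T <= k)%N ->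
  #|above k T|%:R = gbin (n - \dim T) (k - \dim T).
Proof.
move: {2}(k - _)%N (erefl (k - \dim T)%N) => m.
elim: m T => [|m IH] T Em leTk; rewrite Em.
  have dT : \dim T = k by apply/eqP; rewrite eqn_leq leTk -subn_eq0 Em.
  rewrite (_ : above k T = [set T]) ?cards1 //.
  apply/setP => z; rewrite !inE; apply/andP/eqP => [[/eqP dz Tz]|->].
    by apply/eqP; rewrite eq_sym eqEdim Tz dz dT /=.
  by rewrite dT.
have ltTk : (\dim T < k)%N by rewrite -subn_gt0 Em.
have tm : theta m.+1 != 0 by rewrite gt_eqF // theta_gt0.
apply: (mulfI tm); rewrite /= mulrA mulrCA divff // mulr1.
have -> : (n - \dim T)%N = (\dim {:vT} - \dim T)%N by rewrite dimvf /dim /= mul1n.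
rewrite -(count_covers (subvf T)) [RHS]big_distrl /= -sum1_card natr_sum big_distrr /=.
transitivity (\sum_(W : {vspace vT} | [&& \dim W == (\dim T).+1, (T <= W)%VS & (W <= fullv)%VS])
   \sum_(z in above k T | (W <= z)%VS) (1 : rat)); last first.
  apply: eq_bigr => W /and3P[/eqP dW TW _].
  rewrite mul1r dimvf /dim /= mul1n -subnS -dW.
  have <- : (k - \dim W)%N = m by rewrite dW subnS Em.
  rewrite -IH ?dW ?subnS ?Em // -sum1_card natr_sum; apply: eq_bigl => z.
  rewrite !inE; case: eqP => //= _; apply: andb_idl; exact: subv_trans.
rewrite (exchange_big_dep (mem (above k T))) /=; last by move=> W z _ /andP[].
apply: eq_bigr => z; rewrite inE => /andP[/eqP dz Tz].
rewrite mulr1 -Em -{1}dz -(count_covers Tz); apply: eq_bigl => W.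
by rewrite dz eqxx Tz subvf !andbT -!andbA.
Qed.

End SubspaceCounts.

(** * Second and third moments of point weights over regular families *)

Section Moments.

Variables (F : finFieldType) (n : nat).
Local Notation vT := 'rV[F]_n.
Local Notation q := (#|F|%:R : rat).
Local Notation theta := (theta F).
Local Notation gbin := (gbin F).
Local Notation point P := (\dim P == 1%N).
Implicit Types (P Q T U W z H : {vspace vT}) (Z : {set {vspace vT}}).

Definition kspaces k : {set {vspace vT}} := [set z | \dim z == k].

(** A design-like regularity. The zero space is excluded since the [r]-th moment only involves spans
    of at most [r] points. *)
Definition incident Z (c : nat -> rat) r := forall T,
  (0 < \dim T <= r)%N -> #|[set z in Z | (T <= z)%VS]|%:R = c (\dim T).

Lemma incident_points r : incident (kspaces 1) (fun j => (j == 1%N)%:R) r.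
Proof.
move=> T /andP[T0 _]; case: eqP => [dT|ndT].
  have -> : [set z in kspaces 1 | (T <= z)%VS] = above 1 T.
    by apply/setP => z; rewrite !inE.
  by rewrite card_above ?dT.
rewrite (_ : [set _ in _ | _] = set0) ?cards0 //; apply/setP => z; rewrite !inE.
apply/negP => /andP[/eqP dz /dimvS]; rewrite dz => le1.
by apply: ndT; apply/eqP; rewrite eqn_leq le1.
Qed.

Lemma incident_full r : incident [set fullv] (fun=> 1) r.
Proof.
move=> T _; rewrite (_ : [set _ in _ | _] = [set fullv]) ?cards1 //.
by apply/setP => z; rewrite !inE; case: eqP => //= ->; rewrite subvf.
Qed.

Lemma incident_kspaces k r : (r <= k)%N ->
  incident (kspaces k) (fun j => gbin (n - j) (k - j)) r.
Proof.
move=> rk T /andP[_ Tr]; rewrite -card_above ?(leq_trans Tr) //.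
by congr (_%:R); apply: eq_card => z; rewrite !inE.
Qed.

Lemma gbin_hyper m : gbin m.+1 m = theta m.+1.
Proof.
elim: m => [|m IH]; first by rewrite theta1.
by rewrite [gbin _ _]/= IH divfK // gt_eqF // theta_gt0.
Qed.

Lemma incident_hyperplanes r : (r < n)%N ->
  incident (kspaces n.-1) (fun j => theta (n - j)) r.
Proof.
move=> rn T rT; rewrite (incident_kspaces (r := r)) //; last by lia.
case/andP: rT => T0 Tr.
have -> : (n - \dim T = (n.-1 - \dim T).+1)%N by lia.
exact: gbin_hyper.
Qed.

Variable v : {vspace vT} -> rat.

Definition wt z : rat := \sum_(P | point P && (P <= z)%VS) v P.

Lemma wtE z : wt z = \sum_(P | point P) v P * (P <= z)%VS%:R.
Proof.
rewrite /wt big_mkcondr; apply: eq_bigr => P _.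
by case: ifP; rewrite ?mulr1 ?mulr0.
Qed.

Lemma card_indicator Z T :
  #|[set z in Z | (T <= z)%VS]|%:R = \sum_(z in Z) (T <= z)%VS%:R :> rat.
Proof.
rewrite -sum1_card natr_sum [RHS](bigID (fun z => (T <= z)%VS)) /=.
rewrite [X in _ + X]big1 ?addr0 => [|z /andP[_ /negbTE->]] //.
rewrite (eq_bigl (fun z => (z \in Z) && (T <= z)%VS)); last by move=> z; rewrite inE.
by apply: eq_bigr => z /andP[_ ->].
Qed.

Definition pair_sum (c : nat -> rat) :=
  \sum_(P | point P) \sum_(Q | point Q) v P * v Q * c (\dim (P + Q)%VS).

Definition triple_sum (c : nat -> rat) :=
  \sum_(P | point P) \sum_(Q | point Q) \sum_(R | point R)
    v P * v Q * v R * c (\dim (P + Q + R)%VS).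

(** Expanding the square, the pair [P], [Q] contributes once for every member through [P + Q];
    [moment3] does the same with triples. *)
Lemma moment2 Z c : incident Z c 2 ->
  \sum_(z in Z) wt z ^+ 2 =
  pair_sum c.
Proof.
move=> Hc.
transitivity (\sum_(z in Z) \sum_(P | point P) \sum_(Q | point Q)
    v P * v Q * (P + Q <= z)%VS%:R).
  apply: eq_bigr => z _; rewrite expr2 wtE big_distrl /=.
  apply: eq_bigr => P _; rewrite big_distrr /=.
  apply: eq_bigr => Q _; rewrite subv_add -mulnb natrM; ring.
rewrite exchange_big; apply: eq_bigr => P /eqP dP /=.
rewrite exchange_big; apply: eq_bigr => Q /eqP dQ /=.
rewrite -big_distrr -card_indicator Hc //=.
by have [d1 _] := dimv_add_leqif P Q; have d2 := dimvS (addvSl P Q); lia.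
Qed.

Lemma moment3 Z c : incident Z c 3 ->
  \sum_(z in Z) wt z ^+ 3 =
  triple_sum c.
Proof.
move=> Hc.
transitivity (\sum_(z in Z) \sum_(P | point P) \sum_(Q | point Q) \sum_(R | point R)
    v P * v Q * v R * (P + Q + R <= z)%VS%:R).
  apply: eq_bigr => z _; rewrite exprS expr2 wtE big_distrl /=.
  apply: eq_bigr => P _; rewrite big_distrl big_distrr /=.
  apply: eq_bigr => Q _; rewrite !big_distrr /=.
  apply: eq_bigr => R _; rewrite !subv_add -!mulnb !natrM; ring.
rewrite exchange_big; apply: eq_bigr => P /eqP dP /=.
rewrite exchange_big; apply: eq_bigr => Q /eqP dQ /=.
rewrite exchange_big; apply: eq_bigr => R /eqP dR /=.
rewrite -big_distrr -card_indicator Hc //=.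
have d1 := dimv_add_leqif P Q; have d2 := dimv_add_leqif (P + Q) R.
have d3 := dimvS (addvSl P Q); have d4 := dimvS (addvSl (P + Q)%VS R).
by case: d1 d2 => [d1 _] [d2 _]; lia.
Qed.

Lemma moment_points r : \sum_(z in kspaces 1) wt z ^+ r = \sum_(P | point P) v P ^+ r.
Proof.
apply: eq_big => [z|P]; rewrite inE // => /eqP dP.
congr (_ ^+ r); rewrite /wt (big_pred1 P) // => Q /=.
apply/andP/eqP => [[/eqP dQ QP]|->]; last by rewrite dP.
by apply/eqP; rewrite eqEdim QP dP dQ.
Qed.

Hypothesis v0 : \sum_(P | point P) v P = 0.

Lemma moment_full r : \sum_(z in [set fullv]) wt z ^+ r.+1 = 0.
Proof.
rewrite big_set1 /wt (eq_bigl (fun P => point P)) ?v0 ?exprS ?mul0r // => P.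
by rewrite subvf andbT.
Qed.

(** Since [\dim (P + Q)] is 1 or 2, [c] is a combination of the counts of points and of the full
    space, and the full space has zero moment because the weights sum to zero. *)
Lemma moment2_incident Z c : incident Z c 2 ->
  \sum_(z in Z) wt z ^+ 2 = (c 1%N - c 2%N) * \sum_(P | point P) v P ^+ 2.
Proof.
move=> Hc.
have e1 := moment2 (@incident_points 2); have e2 := moment2 (@incident_full 2).
rewrite moment_full in e2; rewrite -moment_points e1 (moment2 Hc).
rewrite -[RHS]addr0 -[X in _ = _ + X](mulr0 (c 2%N)) [X in c 2%N * X]e2.
rewrite /pair_sum !big_distrr -big_split /=.
apply: eq_bigr => P /eqP dP; rewrite !big_distrr -big_split /=.
apply: eq_bigr => Q /eqP dQ.
have [d1 _] := dimv_add_leqif P Q; have d2 := dimvS (addvSl P Q).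
have : (\dim (P + Q) == 1 \/ \dim (P + Q) == 2)%N by lia.
by case=> /eqP -> /=; ring.
Qed.

(* The counts attached to points, hyperplanes and the whole space span all
   functions of [dim (P + Q + R)], so any third moment is a combination of
   those of points and hyperplanes. *)
Lemma moment3_incident Z c : (3 < n)%N -> incident Z c 3 ->
  let b := (c 2%N - c 3%N) / q ^+ (n - 3) in
  \sum_(z in Z) wt z ^+ 3 =
    (c 1%N - c 2%N - b * q ^+ (n - 2)) * \sum_(P | point P) v P ^+ 3
    + b * \sum_(H in kspaces n.-1) wt H ^+ 3.
Proof.
move=> n3 Hc b.
have e1 := moment3 (@incident_points 3); have e2 := moment3 (@incident_full 3).
have e3 := moment3 (@incident_hyperplanes 3 n3).
rewrite moment_full in e2; rewrite -moment_points e1 e3 (moment3 Hc).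
(* This is the coefficient of the full space, whose third moment vanishes; it is fixed by comparing
   the counts at dimension 3. *)
rewrite -[RHS]addr0 -[X in _ = _ + X](mulr0 (c 3%N - b * theta (n - 3))).
rewrite [X in (c 3%N - _) * X]e2 /triple_sum !big_distrr -!big_split /=.
apply: eq_bigr => P /eqP dP; rewrite !big_distrr -!big_split /=.
apply: eq_bigr => Q /eqP dQ; rewrite !big_distrr -!big_split /=.
apply: eq_bigr => R /eqP dR.
have q0 : q ^+ (n - 3) != 0 by rewrite expf_neq0 // gt_eqF // (lt_trans ltr01 (q_gt1 F)).
have t1 : theta (n - 1) = theta (n - 2) + q ^+ (n - 2).
  have := @theta_diff F (n - 2) (n - 1).
  have -> : (n - 1 - (n - 2) = 1)%N by lia.
  by rewrite theta1 mulr1 => <-; [ring | lia].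
have t2 : theta (n - 2) = theta (n - 3) + q ^+ (n - 3).
  have := @theta_diff F (n - 3) (n - 2).
  have -> : (n - 2 - (n - 3) = 1)%N by lia.
  by rewrite theta1 mulr1 => <-; [ring | lia].
have [d1 _] := dimv_add_leqif P Q; have [d2 _] := dimv_add_leqif (P + Q) R.
have d3 := dimvS (addvSl P Q); have d4 := dimvS (addvSl (P + Q)%VS R).
have : (\dim (P + Q + R) == 1 \/ \dim (P + Q + R) == 2 \/ \dim (P + Q + R) == 3)%N by lia.
have bE : b * q ^+ (n - 3) = c 2%N - c 3%N by rewrite divfK.
case=> [|[]] /eqP -> /=; rewrite ?t1 ?t2.
- by rewrite -[c 2%N](subrK (c 3%N)) -bE; ring.
- by rewrite -[c 2%N](subrK (c 3%N)) -bE; ring.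
- by ring.
Qed.

End Moments.

(** * Degrees of subspaces in an intersecting family *)

Section Degrees.

Variables (F : finFieldType) (n k : nat).
Local Notation vT := 'rV[F]_n.
Local Notation q := (#|F|%:R : rat).
Local Notation theta := (theta F).
Local Notation gbin := (gbin F).
Local Notation point P := (\dim P == 1%N).
Implicit Types (P Q T U W x y z : {vspace vT}).

Lemma gbin_ge0 N m : 0 <= gbin N m.
Proof.
elim: m N => [N|m IH N]; first exact: ler01.
by apply: mulr_ge0 (IH _); apply: divr_ge0; apply: theta_ge0.
Qed.

Lemma point_le_point P Q : point P -> point Q -> (P <= Q)%VS -> P = Q.
Proof. by move=> /eqP dP /eqP dQ PQ; apply/eqP; rewrite eqEdim PQ dP dQ. Qed.

Lemma exists_point U : U != 0%VS -> exists2 P, point P & (P <= U)%VS.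
Proof.
move=> U0; exists <[vpick U]>%VS; last by rewrite -memvE memv_pick.
by rewrite dim_vline vpick0 U0.
Qed.

Lemma cap_point_eq0 T P : point P -> ~~ (P <= T)%VS -> (T :&: P)%VS = 0%VS.
Proof.
move=> /eqP dP nPT; apply/eqP; rewrite -dimv_eq0.
have := dimv_sum_cap T P; rewrite dim_add_point // dP.
by move=> h; apply/eqP; lia.
Qed.

Lemma cap_neq0_point T P : point P -> (T :&: P)%VS != 0%VS -> (P <= T)%VS.
Proof. by move=> pP; apply: contraR => nPT; rewrite cap_point_eq0. Qed.

Variable Y : {set {vspace vT}}.

Definition deg T : rat := #|[set z in Y | (T <= z)%VS]|%:R.

Hypothesis Ydim : {in Y, forall z, \dim z = k}.
Hypothesis Yint : {in Y &, forall x y, (x :&: y)%VS != 0%VS}.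

Local Notation N j := (gbin (n - j) (k - j)).

Lemma deg_le T : (\dim T <= k)%N -> deg T <= N (\dim T).
Proof.
move=> Tk; rewrite -card_above // ler_nat subset_leq_card //.
by apply/subsetP => z; rewrite !inE => /andP[/Ydim -> ->]; rewrite eqxx.
Qed.

Lemma card_le_cover (I : finType) (A : {set {vspace vT}}) (p : pred I) (f : I -> {vspace vT}) :
  A \subset Y -> (forall z, z \in A -> exists2 i, p i & (f i <= z)%VS) ->
  #|A|%:R <= \sum_(i | p i) deg (f i).
Proof.
move=> AY cov; rewrite /deg -sum1_card natr_sum.
under [X in _ <= X]eq_bigr => i _ do rewrite card_indicator.
rewrite exchange_big /=.
rewrite [X in _ <= X](bigID (mem A)) /= -[X in X <= _]addr0 lerD //; last first.
  by apply: sumr_ge0 => z _; apply: sumr_ge0 => i _; apply: ler0n.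
rewrite (eq_bigl (fun z => (z \in Y) && (z \in A))); last first.
  by move=> z; rewrite andb_idl // => /(subsetP AY).
apply: ler_sum => z /andP[_ /cov[i pi fz]].
by rewrite (bigD1 i) //= fz lerDl; apply: sumr_ge0 => j _; apply: ler0n.
Qed.

(** A member through [T] meets [x] in some point [Q], hence contains [T + Q]. *)
Lemma deg_cover x T : x \in Y ->
  deg T <= \sum_(Q | point Q && (Q <= x)%VS) deg (T + Q)%VS.
Proof.
move=> xY; apply: card_le_cover => [|z].
  by apply/subsetP => z; rewrite inE => /andP[].
rewrite inE => /andP[zY Tz].
have [Q pQ] := exists_point (Yint xY zY); rewrite subv_cap => /andP[Qx Qz].
by exists Q; rewrite ?pQ ?subv_add ?Tz.
Qed.

(** All [theta k] points of [x] lie outside [T], so each term of [deg_cover] is the degree of a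
    space of dimension one more. *)
Lemma deg_disjoint x T : x \in Y -> (T :&: x)%VS = 0%VS -> (\dim T < k)%N ->
  deg T <= theta k * N (\dim T).+1.
Proof.
move=> xY Tx Tk; apply: le_trans (deg_cover T xY) _.
rewrite -(Ydim xY) -count_points mulr_suml; apply: ler_sum => Q /andP[pQ Qx].
rewrite mul1r; have dQ : \dim (T + Q) = (\dim T).+1.
  apply: dim_add_point; first exact/eqP.
  apply: contraTN pQ => QT; have : (Q <= T :&: x)%VS by rewrite subv_cap QT.
  by rewrite Tx subv0 => /eqP->; rewrite dimv0.
by rewrite -dQ (Ydim xY) deg_le ?dQ.
Qed.

Definition blocking T := [forall y in Y, (T :&: y)%VS != 0%VS].

(** A member missing [P] meets [L] and [M] in points other than [P], with [q] choices on each. These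
    points differ, as the lines share only [P], so they span a line, which lies in at most [N 2]
    members. *)
Lemma deg_two_blocking P L M : point P -> (1 < k)%N ->
  \dim L = 2%N -> \dim M = 2%N -> (P <= L)%VS -> (P <= M)%VS -> L != M ->
  blocking L -> blocking M ->
  #|Y|%:R <= deg P + q ^+ 2 * N 2.
Proof.
move=> pP k1 dL dM PL PM LM /forall_inP bL /forall_inP bM.
have capLM : (L :&: M)%VS = P.
  apply/esym/eqP; rewrite eqEdim subv_cap PL PM (eqP pP) /=.
  have : (L :&: M)%VS != L.
    apply: contraNneq LM => /capv_idPl LM.
    by rewrite eqEdim LM dL dM.
  have /leqifP := dimv_leqif_eq (capvSl L M).
  by case: eqP => // _; rewrite dL.
have -> : #|Y| = (#|[set z in Y | (P <= z)%VS]| + #|[set z in Y | ~~ (P <= z)%VS]|)%N.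
  rewrite -(cardsID [set z | (P <= z)%VS]); congr (_ + _)%N; apply: eq_card => z;
  by rewrite !inE // andbC.
rewrite natrD lerD2l.
have away (K : {vspace vT}) : \dim K = 2%N -> (P <= K)%VS ->
    \sum_(Q | [&& point Q, (Q <= K)%VS & Q != P]) (1 : rat) = q.
  move=> dK PK; have := count_points K.
  rewrite (bigD1 P) ?pP ?PK //= dK /theta => h.
  transitivity ((q ^+ 2 - 1) / (q - 1) - 1); last first.
    by field; exact: q_sub1_neq0.
  by rewrite -h addrAC subrr add0r; apply: eq_bigl => Q; rewrite andbA.
pose a (K Q : {vspace vT}) := [&& point Q, (Q <= K)%VS & Q != P].
have -> : q ^+ 2 * N 2 = \sum_(i : {vspace vT} * {vspace vT} | a L i.1 && a M i.2) N 2.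
  rewrite -(pair_big (a L) (a M) (fun _ _ => N 2)) /= expr2 -{1}(away L) //.
  rewrite -(away M) // -mulrA big_distrl; apply: eq_bigr => Q _ /=.
  by rewrite mul1r big_distrl /=; apply: eq_bigr => R _; rewrite mul1r.
apply: le_trans (card_le_cover (f := fun i : {vspace vT} * {vspace vT} => (i.1 + i.2)%VS)
    (p := fun i => a L i.1 && a M i.2) _ _) _; rewrite {}/a.
- by apply/subsetP => z; rewrite inE => /andP[].
- move=> z; rewrite inE => /andP[zY nPz].
  have [Q pQ] := exists_point (bL z zY); rewrite subv_cap => /andP[QL Qz].
  have [R pR] := exists_point (bM z zY); rewrite subv_cap => /andP[RM Rz].
  exists (Q, R); rewrite /= ?subv_add ?Qz ?Rz // pQ pR QL RM /=.
  by apply/andP; split; apply: contraNneq nPz => <-.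
apply: ler_sum => -[Q R] /= /andP[/and3P[pQ QL QP] /and3P[pR RM _]].
have nRQ : ~~ (R <= Q)%VS.
  apply: contraNN QP => RQ; move: RM; rewrite (point_le_point pR pQ RQ) => QM.
  by apply/eqP/(point_le_point pQ pP); rewrite -capLM subv_cap QL.
have dQR : \dim (Q + R) = 2%N by rewrite dim_add_point ?(eqP pQ) ?(eqP pR).
by rewrite -dQR deg_le ?dQR.
Qed.

(** Apply [deg_cover] to the [theta k] lines joining [P] to points of [x]. A line missed by some
    member has degree at most [theta k * N 3] by [deg_disjoint]; at most one line is blocking, and
    it costs an extra [N 2]. *)
Lemma deg_one_blocking x P : x \in Y -> point P -> ~~ (P <= x)%VS -> (2 < k)%N ->
  (forall L M, \dim L = 2%N -> \dim M = 2%N -> (P <= L)%VS -> (P <= M)%VS ->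
     blocking L -> blocking M -> L = M) ->
  deg P <= N 2 + theta k ^+ 2 * N 3.
Proof.
move=> xY pP nPx k2 uniq_blocking; apply: le_trans (deg_cover P xY) _.
have dPQ Q : point Q && (Q <= x)%VS -> \dim (P + Q) = 2%N.
  case/andP=> pQ Qx; rewrite dim_add_point ?(eqP pP) ?(eqP pQ) //.
  by apply: contraNN nPx => QP; rewrite -(point_le_point pQ pP QP).
apply: (@le_trans _ _ (\sum_(Q | point Q && (Q <= x)%VS)
    (theta k * N 3 + (blocking (P + Q)%VS)%:R * N 2))).
  apply: ler_sum => Q hQ; have d2 := dPQ Q hQ.
  case: (boolP (blocking _)) => [_|]; rewrite ?mul1r ?mul0r ?addr0.
    apply: ler_wpDl; first by rewrite mulr_ge0 ?theta_ge0 ?gbin_ge0.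
    by rewrite -d2 deg_le // d2 ltnW.
  rewrite negb_forall_in => /exists_inP[y yY]; rewrite negbK => /eqP PQy.
  by rewrite -d2 (deg_disjoint yY PQy) // d2.
rewrite big_split /= addrC lerD //; last first.
  have tk := count_points x; rewrite (Ydim xY) in tk.
  rewrite expr2 -mulrA -[X in _ <= X * _]tk mulr_suml.
  by apply: ler_sum => Q _; rewrite mul1r.
rewrite -mulr_suml -[leRHS]mul1r ler_wpM2r ?gbin_ge0 //.
case: (pickP (fun Q => [&& point Q, (Q <= x)%VS & blocking (P + Q)%VS])) => [Q|none]; last first.
  by rewrite big1 ?ler01 // => Q /andP[pQ Qx]; have := none Q; rewrite pQ Qx /= => ->.
case/and3P=> pQ Qx bQ; rewrite (bigD1 Q) ?pQ //= bQ big1 ?addr0 // => R /andP[hR RQ].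
(* A second blocking line [P + R] would equal [P + Q], hence [Q + R], and so put [P] inside [x]. *)
apply/eqP; rewrite pnatr_eq0 eqb0; apply: contraNN nPx => bR.
have eqPQR : (P + Q)%VS = (P + R)%VS.
  by apply: uniq_blocking; rewrite ?dPQ ?pQ ?addvSl.
case/andP: hR => pR Rx.
have nRQ : ~~ (R <= Q)%VS by apply: contraNN RQ => /(point_le_point pR pQ)->.
have dQR : \dim (Q + R) = 2%N by rewrite dim_add_point ?(eqP pQ) ?(eqP pR).
have /eqP eQR : (Q + R == P + Q)%VS.
  by rewrite eqEdim dQR dPQ ?pQ // subv_add addvSr eqPQR addvSr.
by apply: (subv_trans (addvSl P Q)); rewrite -eQR subv_add Qx.
Qed.

End Degrees.

(** * Orthogonal complements and duality *)

Section Perp.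

Variables (F : fieldType) (n : nat).
Local Notation vT := 'rV[F]_n.
Implicit Types (U W : {vspace vT}).

Definition vbasis_mx U := \matrix_(i < \dim U) (vbasis U)`_i.

(** The complement for the standard dot product: the vectors orthogonal to a basis of [U]. *)
Definition perp U : {vspace vT} := lker (linfun (mulmxr (vbasis_mx U)^T)).

Lemma mem_perp U (w : vT) :
  reflect (forall u, u \in U -> w *m u^T = 0) (w \in perp U).
Proof.
rewrite memv_ker lfunE /=; apply: (iffP eqP) => [w0 u uU|wU].
  rewrite (coord_vbasis uU) linear_sum mulmx_sumr big1 // => i _.
  rewrite linearZ -scalemxAr.
  suff -> : w *m ((vbasis U)`_i)^T = 0 by rewrite scaler0.
  have /rowP/(_ i) := w0; rewrite !mxE => e.
  apply/matrixP => a b; rewrite !ord1 !mxE -[RHS]e.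
  by apply: eq_bigr => j _; rewrite !mxE.
apply/rowP => i; have := wU (vbasis U)`_i (vbasis_mem (mem_nth _ _)).
rewrite size_tuple ltn_ord => /(_ isT)/matrixP/(_ 0 0); rewrite !mxE => e.
by rewrite -[RHS]e; apply: eq_bigr => j _; rewrite !mxE.
Qed.

Lemma vbasis_mx_free U : row_free (vbasis_mx U).
Proof.
rewrite -kermx_eq0; apply/rowV0P => c /sub_kermxP; rewrite mulmx_sum_row => c0.
have /freeP fU := basis_free (vbasisP U); apply/rowP => i; rewrite mxE.
apply: (fU (fun j => c 0 j)); rewrite -[RHS]c0; apply: eq_bigr => j _.
by rewrite rowK.
Qed.

(** Rank-nullity: the basis matrix has independent rows, so its pseudo-inverse supplies preimages
    and the map is onto. *)
Lemma dim_perp U : \dim (perp U) = (n - \dim U)%N.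
Proof.
pose f : 'Hom(vT, 'rV[F]_(\dim U)) := linfun (mulmxr (vbasis_mx U)^T).
have imf : limg f = fullv.
  apply/vspaceP => c; rewrite memvf; apply/memv_imgP.
  exists (c *m (pinvmx (vbasis_mx U))^T); rewrite ?memvf // lfunE /=.
  by rewrite -mulmxA -trmx_mul mulmxVp ?vbasis_mx_free // trmx1 mulmx1.
have := limg_ker_dim f fullv.
by rewrite imf capfv !dimvf /dim /= !mul1n -/(perp U) => h; rewrite -[X in (X - _)%N]h addnK.
Qed.

Lemma perpS U W : (U <= W)%VS -> (perp W <= perp U)%VS.
Proof.
move=> /subvP UW; apply/subvP => w /mem_perp wW.
by apply/mem_perp => u /UW; apply: wW.
Qed.

(** Symmetry of the dot product gives one inclusion, and dimensions give equality. *)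
Lemma perpK : involutive perp.
Proof.
move=> U; apply/esym/eqP; rewrite eqEdim !dim_perp.
have -> : (n - (n - \dim U) = \dim U)%N.
  by rewrite subKn //; have := dimvS (subvf U); rewrite dimvf /dim /= mul1n.
rewrite leqnn andbT; apply/subvP => u uU; apply/mem_perp => w /mem_perp wU.
by rewrite -[LHS]trmxK trmx_mul trmxK wU // trmx0.
Qed.

Lemma sub_perp U W : (perp U <= perp W)%VS = (W <= U)%VS.
Proof. by apply/idP/idP => /perpS //; rewrite !perpK. Qed.

End Perp.

(** * The third-moment inequality *)

Section ThirdMoment.

Variables (F : finFieldType) (n k : nat) (Y : {set {vspace 'rV[F]_n}}).
Local Notation vT := 'rV[F]_n.
Local Notation q := (#|F|%:R : rat).
Local Notation theta := (theta F).
Local Notation N j := (gbin F (n - j) (k - j)).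
Local Notation point P := (\dim P == 1%N).
Local Notation deg := (deg Y).
Local Notation y := (#|Y|%:R : rat).
Implicit Types (P Q T U W z H : {vspace vT}).

Hypothesis Ydim : {in Y, forall z, \dim z = k}.
Hypothesis Yint : {in Y &, forall x y, (x :&: y)%VS != 0%VS}.
Hypothesis k_ge3 : (2 < k)%N.
Hypothesis k_lt_n : (k < n)%N.

Definition mean_deg : rat := y * theta k / theta n.
Definition dev P : rat := deg P - mean_deg.
Local Notation s := (mean_deg * theta k).
Local Notation V2 := (\sum_(P : {vspace vT} | point P) dev P ^+ 2).

Lemma sum_deg U :
  \sum_(P | point P && (P <= U)%VS) deg P = \sum_(z in Y) theta (\dim (z :&: U)).
Proof.
rewrite /deg; under eq_bigr => P _ do rewrite card_indicator.
rewrite exchange_big; apply: eq_bigr => z _ /=.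
rewrite -count_points [RHS](eq_bigl (fun P => point P && (P <= U)%VS && (P <= z)%VS)).
  by rewrite [RHS]big_mkcondr; apply: eq_bigr => P _; case: ifP.
by move=> P; rewrite subv_cap -andbA [(P <= z)%VS && _]andbC.
Qed.

(** For a k-space the subtracted term is [s]. Hence [wt dev z + s] is a sum of point counts of
    intersections: non-negative, and at least [y] when [z] meets every member. *)
Lemma wt_devE U : wt dev U = \sum_(z in Y) theta (\dim (z :&: U)) - mean_deg * theta (\dim U).
Proof.
rewrite /wt sumrB sum_deg; congr (_ - _).
by rewrite -count_points mulr_sumr; apply: eq_bigr => P _; rewrite mulr1.
Qed.

Lemma sum_dev : \sum_(P | point P) dev P = 0.
Proof.
have := wt_devE fullv; rewrite /wt (eq_bigl (fun P => point P)); last first.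
  by move=> P; rewrite subvf andbT.
move=> ->; rewrite dimvf /dim /= mul1n /mean_deg.
rewrite divfK ?gt_eqF ?theta_gt0 ?(leq_trans _ k_lt_n) //.
rewrite (eq_bigr (fun=> theta k)) => [|z zY]; last by rewrite capvf Ydim.
by rewrite sumr_const mulr_natl subrr.
Qed.

Lemma theta_ge1 d : (0 < d)%N -> 1 <= theta d.
Proof.
move=> d0; rewrite ler_pdivlMr ?subr_gt0 ?q_gt1 // mul1r lerD2r.
by rewrite -{1}[q]expr1 ler_weXn2l // ltW ?q_gt1.
Qed.

Lemma wt_dev_ge z : \dim z = k -> 0 <= wt dev z + s.
Proof.
move=> dz; rewrite wt_devE dz subrK.
by apply: sumr_ge0 => w _; apply: theta_ge0.
Qed.

Lemma wt_dev_ge_card z : z \in Y -> y <= wt dev z + s.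
Proof.
move=> zY; rewrite wt_devE (Ydim zY) subrK -sum1_card natr_sum.
by apply: ler_sum => w wY; rewrite theta_ge1 // lt0n dimv_eq0 Yint.
Qed.

(** Exchanging sums gives the sum of [dev P * deg P]; replacing [deg] by [dev] changes nothing since
    the deviations sum to zero. *)
Lemma sum_wt_dev : \sum_(z in Y) wt dev z = V2.
Proof.
transitivity (\sum_(P | point P) dev P * deg P).
  under eq_bigr => z _ do rewrite wtE.
  rewrite exchange_big; apply: eq_bigr => P _ /=.
  by rewrite -mulr_sumr -card_indicator.
apply/eqP; rewrite -subr_eq0 -sumrB.
rewrite (eq_bigr (fun P => mean_deg * dev P)) => [|P _]; last by rewrite /dev; ring.
by rewrite -mulr_sumr sum_dev mulr0.
Qed.

Lemma V2_ge : y * (y - s) <= V2.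
Proof.
rewrite -sum_wt_dev mulr_natl -sumr_const; apply: ler_sum => z zY.
by rewrite lerBlDr wt_dev_ge_card.
Qed.

(** A member meets [H] in [theta k.-1] points, and in [q ^+ k.-1] more if it lies inside [H]. *)
Lemma wt_hyperplane H : \dim H = n.-1 ->
  wt dev H = theta k.-1 * y + q ^+ k.-1 * #|[set z in Y | (z <= H)%VS]|%:R
             - mean_deg * theta n.-1.
Proof.
move=> dH; rewrite wt_devE dH; congr (_ - _).
have -> : #|[set z in Y | (z <= H)%VS]|%:R = \sum_(z in Y) (z <= H)%VS%:R :> rat.
  rewrite -sum1_card natr_sum big_mkcond [RHS]big_mkcond; apply: eq_bigr => z _.
  by rewrite inE; case: (z \in Y) => //=; case: (z <= H)%VS.
rewrite -sum1_card natr_sum !mulr_sumr -big_split; apply: eq_bigr => z zY /=.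
rewrite mulr1; case: (boolP (z <= H)%VS) => zH.
  rewrite (capv_idPl zH) (Ydim zY) mulr1.
  have := @theta_diff F k.-1 k (leq_pred _).
  have -> : (k - k.-1 = 1)%N by lia.
  by rewrite theta1 mulr1 => <-; ring.
rewrite mulr0 addr0; congr theta.
have /eqP zHf : (z + H)%VS == fullv.
  rewrite eqEdim subvf /= dimvf /dim /= mul1n.
  have /leqifP := dimv_leqif_sup (addvSr z H); rewrite subv_add subvv andbT (negbTE zH) dH.
  by lia.
have := dimv_sum_cap z H; rewrite zHf (Ydim zY) dH dimvf /dim /= mul1n; lia.
Qed.

(** Here [a] and [b] are the coefficients of [moment3_incident]. The sum of [wt ^+ 2 * (wt + s)]
    over k-spaces is at least [V2 ^+ 2] and at most a multiple of [V2]; cancel [V2] and apply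
    [V2_ge]. *)
Lemma third_moment_bound (D b a : rat) :
  b = (N 2 - N 3) / q ^+ (n - 3) -> a = N 1 - N 2 - b * q ^+ (n - 2) ->
  0 <= b -> 0 <= a -> n = (2 * k)%N -> 0 < y -> s < y ->
  (forall P, point P -> deg P <= D) ->
  (forall H, \dim H = n.-1 -> #|[set z in Y | (z <= H)%VS]|%:R <= D) ->
  y * (y - s) <= s * (N 1 - N 2)
                 + (a + b * (q ^+ k.-1 * q ^+ (n - 2))) * (D - mean_deg).
Proof.
move=> bE aE b0 a0 nk y0 sy degD hypD.
have V2_gt0 : 0 < V2 by apply: lt_le_trans V2_ge; rewrite mulr_gt0 // subr_gt0.
apply: le_trans V2_ge _; rewrite -(ler_pM2r V2_gt0) -expr2.
have kn : (2 <= k)%N := ltnW k_ge3.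
have m2 := moment2_incident sum_dev (@incident_kspaces F n _ _ kn).
have m3 := moment3_incident sum_dev (leq_ltn_trans k_ge3 k_lt_n) (@incident_kspaces F n _ _ k_ge3).
rewrite /= -bE -aE in m3.
have h2 := moment2_incident sum_dev (@incident_hyperplanes F n 2 (ltn_trans k_ge3 k_lt_n)).
rewrite theta_diff in h2; last by lia.
have tn : (n - 1 - (n - 2) = 1)%N by lia.
rewrite tn theta1 mulr1 in h2.
have cubeP : \sum_(P | point P) dev P ^+ 3 <= (D - mean_deg) * V2.
  rewrite mulr_sumr; apply: ler_sum => P pP.
  by rewrite exprS ler_wpM2r ?sqr_ge0 // lerD2r degD.
have cubeH : \sum_(H in kspaces F n n.-1) wt dev H ^+ 3
             <= q ^+ k.-1 * (D - mean_deg) * (q ^+ (n - 2) * V2).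
  rewrite -h2 mulr_sumr; apply: ler_sum => H; rewrite inE => /eqP dH.
  rewrite exprS ler_wpM2r ?sqr_ge0 // (wt_hyperplane dH).
  (* Because [n = 2k], the mean number of members in a hyperplane equals the mean point degree. *)
  have -> : q ^+ k.-1 * (D - mean_deg) = theta k.-1 * y + q ^+ k.-1 * D - mean_deg * theta n.-1.
    have qk : q ^+ k = q * q ^+ k.-1 by rewrite -exprS prednK // ltnW // ltnW.
    have qn1 : q ^+ n.-1 = q * (q ^+ k.-1) ^+ 2.
      by rewrite -exprM -exprS; congr (_ ^+ _); lia.
    have qn : q ^+ n = (q * q ^+ k.-1) ^+ 2.
      by rewrite -exprS -exprM; congr (_ ^+ _); lia.
    have tn0 : theta n != 0 by rewrite gt_eqF // theta_gt0 // (leq_trans _ k_lt_n).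
    move: tn0; rewrite /mean_deg /theta qk qn1 qn.
    move: (q_sub1_neq0 F) => q1 tn0.
    have t0 : (q * q ^+ k.-1) ^+ 2 - 1 != 0.
      by apply: contraNneq tn0 => ->; rewrite mul0r.
    by field; rewrite q1 t0.
  by rewrite lerD2r lerD2l ler_wpM2l ?hypD // exprn_ge0 // ler0n.
have lower : V2 ^+ 2 <= \sum_(z in kspaces F n k) wt dev z ^+ 2 * (wt dev z + s).
  apply: (@le_trans _ _ (\sum_(z in Y) wt dev z ^+ 2 * (wt dev z + s))); last first.
    rewrite [leRHS](bigID (mem Y)) /= [X in _ <= X + _](eq_bigl (mem Y)) => [|z]; last first.
      by rewrite inE andb_idl // => /Ydim/eqP.
    rewrite lerDl; apply: sumr_ge0 => z; rewrite inE => /andP[/eqP dz _].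
    by rewrite mulr_ge0 ?sqr_ge0 ?wt_dev_ge.
  apply: (@le_trans _ _ (y * \sum_(z in Y) wt dev z ^+ 2)); last first.
    rewrite mulr_sumr; apply: ler_sum => z zY.
    by rewrite mulrC ler_wpM2l ?sqr_ge0 ?wt_dev_ge_card.
  (* Cauchy-Schwarz on [Y], where the weights sum to [V2]. *)
  have : 0 <= \sum_(z in Y) (y * wt dev z - V2) ^+ 2.
    by apply: sumr_ge0 => z _; rewrite sqr_ge0.
  rewrite (eq_bigr (fun z => y * y * wt dev z ^+ 2 - 2 * y * V2 * wt dev z + V2 ^+ 2)); last first.
    by move=> z _; ring.
  rewrite big_split sumrB -!mulr_sumr sum_wt_dev sumr_const -mulr_natl /= => cs.
  rewrite -(ler_pM2l y0) -subr_ge0; move: cs; congr (0 <= _); ring.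
apply: le_trans lower _.
rewrite (eq_bigr (fun z => wt dev z ^+ 3 + s * wt dev z ^+ 2)); last by move=> z _; ring.
rewrite big_split /= -mulr_sumr m2 m3 [leLHS]addrC [leRHS]mulrDl lerD //; first by rewrite mulrA.
rewrite [(a + _) * _]mulrDl [leRHS]mulrDl lerD //.
  by rewrite -mulrA ler_wpM2l.
apply: le_trans (ler_wpM2l b0 cubeH) _.
by rewrite le_eqVlt; apply/orP; left; apply/eqP; ring.
Qed.

End ThirdMoment.

(** * Numerical estimates, with [b], [A], [c] standing for the powers of [q] with exponents [k - 2],
    [k - 1], [k] *)

Section NumericalEstimate.

Variables (R : realFieldType) (q b : R).
Local Notation A := (q * b).
Local Notation c := (q ^+ 2 * b).

Lemma A_ge16 : 4 <= q -> q <= b -> 16 <= A.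
Proof. by move=> q4 qb; have b4 : 4 <= b := le_trans q4 qb; nra. Qed.

(** The left side is the degree cap [D] times [(q - 1) ^+ 2 / (g * (c - 1))], with [g] the common
    factor of [gbin_values]. *)
Lemma degree_estimate : 4 <= q -> q <= b ->
  (A ^+ 2 - 1) / (c - 1) * (q - 1) ^+ 2 + (c - 1) * (b - 1) <= A ^+ 2 - 7 / 4 * A.
Proof.
move=> q4 qb; have A16 := A_ge16 q4 qb.
have c1 : 0 < c - 1 by nra.
have h1 : (A ^+ 2 - 1) / (c - 1) <= (A + 1) / q.
  rewrite ler_pdivrMr // mulrAC ler_pdivlMr; last lra.
  by rewrite -subr_ge0 (_ : _ - _ = (A + 1) * (q - 1)); [nra | ring].
(* Equivalent to [1 / q <= 1 / 4]; this is the source of the constant [7 / 4]. *)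
have h2 : (q - 1) ^+ 2 / q <= q - 7 / 4 by rewrite ler_pdivrMr; nra.
have h3 : (A ^+ 2 - 1) / (c - 1) * (q - 1) ^+ 2 <= (A + 1) * (q - 7 / 4).
  apply: (@le_trans _ _ ((A + 1) / q * (q - 1) ^+ 2)).
    by rewrite ler_wpM2r ?sqr_ge0.
  by rewrite -mulrA [q^-1 * _]mulrC ler_wpM2l //; lra.
apply: le_trans (lerD h3 (lexx _)) _; rewrite -subr_ge0.
rewrite (_ : _ - _ = b - q + 3 / 4); first by lra.
by field.
Qed.

Lemma final_estimate t : 4 <= q -> q <= b -> 3 * (A ^+ 2 - 1) <= (q - 1) * t ->
  2 * A ^+ 2 * ((A ^+ 2 - 1) / (c - 1) + (c - 1) * (b - 1) / (q - 1) ^+ 2)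
  < t * (t - t / (q - 1) - A * (A + 1) / (q - 1)).
Proof.
move=> q4 qb ht; have A16 := A_ge16 q4 qb; have q1 : 0 < q - 1 by lra.
have q10 : q - 1 != 0 by rewrite gt_eqF.
have c1 : c - 1 != 0 by rewrite gt_eqF //; nra.
rewrite -(ltr_pM2r (exprn_gt0 2 q1)).
have -> : 2 * A ^+ 2 * ((A ^+ 2 - 1) / (c - 1) + (c - 1) * (b - 1) / (q - 1) ^+ 2) * (q - 1) ^+ 2
   = 2 * A ^+ 2 * ((A ^+ 2 - 1) / (c - 1) * (q - 1) ^+ 2 + (c - 1) * (b - 1)).
  by field; rewrite ?q10 ?c1.
have -> : t * (t - t / (q - 1) - A * (A + 1) / (q - 1)) * (q - 1) ^+ 2
   = ((q - 1) * t) * ((q - 2) * t - A * (A + 1)) by field; rewrite ?q10.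
have hA : 0 <= 2 * A ^+ 2 by nra.
apply: le_lt_trans (ler_wpM2l hA (degree_estimate q4 qb)) _.
have hA2 : 0 < A ^+ 2 - 1 by nra.
have t0 : 0 < t by rewrite -(pmulr_rgt0 _ q1); nra.
(* For [q >= 4], [q - 2] is at least two thirds of [q - 1]. What remains is a polynomial inequality
   in [A >= 16] alone. *)
have h2 : 2 * (A ^+ 2 - 1) <= (q - 2) * t by nra.
apply: (@lt_le_trans _ _ (3 * (A ^+ 2 - 1) * (2 * (A ^+ 2 - 1) - A * (A + 1)))); last first.
  by apply: ler_pM => //; nra.
move: A16; move: (A) => x x16; nra.
Qed.

(** The leftmost term is [s]: for [n = 2k] the ratio of [theta n] to [theta k] is [c + 1]. *)
Lemma mean_share_lt y : 4 <= q -> q <= b -> 0 < y ->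
  y / (c + 1) * ((c - 1) / (q - 1)) <= y / (q - 1) < y.
Proof.
move=> q4 qb y0; have A16 := A_ge16 q4 qb; have q1 : 0 < q - 1 by lra.
have c1 : 0 < c + 1 by nra.
apply/andP; split; last by rewrite ltr_pdivrMr // ltr_pMr //; lra.
rewrite mulrA ler_pM2r ?invr_gt0 // -mulrA ger_pMr // mulrC.
by rewrite ler_pdivrMr // mul1r; lra.
Qed.

(** Replacing [m * th] by the larger [y / (q - 1)] and dropping [- m] weakens the moment inequality;
    with [t = y / (g * (c - 1))] the result contradicts [final_estimate]. *)
Lemma moment_contradiction g y : 4 <= q -> q <= b -> 0 < g ->
  let N2 := g * (q ^+ 2 * b ^+ 2 - 1) in
  let th := (c - 1) / (q - 1) in
  let m := y / (c + 1) in
  3 * th * N2 <= y ->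
  y * (y - m * th) <= m * th * (g * (c - 1) * A * (A + 1))
     + 2 * (g * (c - 1) * A ^+ 2) * (N2 + th ^+ 2 * (g * (b - 1)) - m) -> False.
Proof.
move=> q4 qb g0 N2 th m bigy; apply/negP; rewrite -ltNge.
have A16 := A_ge16 q4 qb; have q1 : 0 < q - 1 by lra.
have c1 : 0 < c - 1 by nra.
have G0 : 0 < g * (c - 1) by rewrite mulr_gt0.
pose t := y / (g * (c - 1)).
have yE : y = g * (c - 1) * t by rewrite mulrC divfK // gt_eqF.
have q10 : q - 1 != 0 by rewrite gt_eqF.
have c10 : c - 1 != 0 by rewrite gt_eqF.
have ht : 3 * (A ^+ 2 - 1) <= (q - 1) * t.
  have Gq : 0 < g * (c - 1) / (q - 1) by rewrite divr_gt0.
  rewrite -(ler_pM2l Gq).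
  have <- : 3 * th * N2 = g * (c - 1) / (q - 1) * (3 * (A ^+ 2 - 1)).
    by rewrite /th /N2; field.
  suff -> : g * (c - 1) / (q - 1) * ((q - 1) * t) = y by [].
  by rewrite mulrA divfK // yE.
have A2 : 0 < A ^+ 2 - 1 by nra.
have t0 : 0 < t by rewrite -(pmulr_rgt0 _ q1) (lt_le_trans _ ht) // mulr_gt0.
have y0 : 0 < y by rewrite yE mulr_gt0.
have /andP[sle _] := mean_share_lt q4 qb y0; rewrite -/th -/m in sle.
have m0 : 0 <= m by rewrite divr_ge0 ?ltW //; lra.
have := final_estimate q4 qb ht; rewrite -(ltr_pM2l (mulr_gt0 G0 G0)).
have -> : g * (c - 1) * (g * (c - 1)) *
    (2 * A ^+ 2 * ((A ^+ 2 - 1) / (c - 1) + (c - 1) * (b - 1) / (q - 1) ^+ 2))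
    = 2 * (g * (c - 1) * A ^+ 2) * (N2 + th ^+ 2 * (g * (b - 1))).
  by rewrite /N2 /th; field; rewrite q10 c10.
have -> : g * (c - 1) * (g * (c - 1)) * (t * (t - t / (q - 1) - A * (A + 1) / (q - 1)))
    = y * (y - y / (q - 1)) - y / (q - 1) * (g * (c - 1) * A * (A + 1)).
  by rewrite yE; field.
set u := N2 + _; set K := g * (c - 1) * A ^+ 2; set E := g * (c - 1) * A * (A + 1) => h.
have K0 : 0 <= K by rewrite /K mulr_ge0 ?sqr_ge0 // ltW.
have E0 : 0 <= E by rewrite /E !mulr_ge0 // ?ltW //; lra.
apply: (@le_lt_trans _ _ (y / (q - 1) * E + 2 * K * u)).
  apply: lerD; first by rewrite ler_wpM2r.
  by apply: ler_wpM2l; [apply: mulr_ge0 | rewrite lerBlDr lerDl].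
rewrite -ltrBrDl; apply: lt_le_trans h _; rewrite lerB // ler_wpM2l ?(ltW y0) //.
by rewrite lerB.
Qed.

End NumericalEstimate.

(** * The bound for [k >= 3] *)

Lemma gbin_gt0 (F : finFieldType) N m : (m <= N)%N -> 0 < gbin F N m.
Proof.
elim: m N => [N _|m IH [|N]] //= mN.
by rewrite mulr_gt0 ?IH // divr_gt0 ?theta_gt0.
Qed.

Section Bound.

Variables (F : finFieldType) (k : nat).
Local Notation n := (2 * k)%N.
Local Notation vT := 'rV[F]_n.
Local Notation q := (#|F|%:R : rat).
Local Notation theta := (theta F).
Local Notation N j := (gbin F (n - j) (k - j)).
Local Notation point P := (\dim P == 1%N).
Local Notation D := (N 2 + theta k ^+ 2 * N 3).
Implicit Types (P H x z : {vspace vT}) (Y : {set {vspace vT}}).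

Definition intersecting Y :=
  {in Y, forall z, \dim z = k} /\ {in Y &, forall x y, (x :&: y)%VS != 0%VS}.

Hypothesis k_ge3 : (2 < k)%N.

Lemma q2_le_theta : q ^+ 2 <= theta k.
Proof.
have q1 := q_gt1 F.
have t3 : theta 3 = 1 + q + q ^+ 2.
  by rewrite /theta; field; exact: q_sub1_neq0.
have := theta_diff F k_ge3; rewrite t3 => h.
have : 0 <= q ^+ 3 * theta (k - 3) by rewrite mulr_ge0 ?theta_ge0 ?exprn_ge0 ?ler0n.
by rewrite -h; lra.
Qed.

(** Two blocking lines through [P] would give [|Y| <= deg P + q^2 * N 2]. Both terms are at most
    [theta k * N 2], the first because [P] misses [x], so [|Y|] would be too small. *)
Lemma point_degree_bound Y x P : intersecting Y ->
  3 * theta k * N 2 <= #|Y|%:R -> x \in Y -> point P -> ~~ (P <= x)%VS ->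
  deg Y P <= D.
Proof.
move=> [Ydim Yint] bigY xY pP nPx.
apply: (deg_one_blocking Ydim Yint xY pP nPx k_ge3) => L M dL dM PL PM bL bM.
apply/eqP/negPn/negP => LM.
have := deg_two_blocking Ydim pP (ltnW k_ge3) dL dM PL PM LM bL bM.
have Px : (P :&: x)%VS = 0%VS by rewrite capvC cap_point_eq0.
have := deg_disjoint Ydim Yint xY Px; rewrite (eqP pP) => /(_ (ltnW k_ge3)).
have N20 : 0 < N 2 by apply: gbin_gt0; lia.
have qk := q2_le_theta; have tk : 0 < theta k by rewrite theta_gt0 //; lia.
have h1 : q ^+ 2 * N 2 <= theta k * N 2 by rewrite ler_pM2r.
have h2 : 0 < theta k * N 2 by rewrite mulr_gt0.
rewrite -mulrA in bigY => d1 d2.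
by clear -bigY h1 h2 d1 d2; lra.
Qed.

(** For [n = 2k], [perp] carries [Y] to an intersecting family of k-spaces and [H] to a point,
    reducing this to [point_degree_bound]. *)
Lemma hyperplane_degree_bound Y x H : intersecting Y ->
  3 * theta k * N 2 <= #|Y|%:R -> x \in Y -> \dim H = n.-1 -> ~~ (x <= H)%VS ->
  #|[set z in Y | (z <= H)%VS]|%:R <= D.
Proof.
move=> [Ydim Yint] bigY xY dH nxH.
have cY : #|@perp F n @: Y| = #|Y| := card_imset _ (can_inj (@perpK F n)).
have -> : #|[set z in Y | (z <= H)%VS]|%:R = deg (@perp F n @: Y) (perp H).
  congr (_%:R); rewrite -(card_imset _ (can_inj (@perpK F n))).
  apply: eq_card => z; rewrite inE; apply/imsetP/andP => [[w]|[/imsetP[w wY ->]]].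
    by rewrite inE => /andP[wY wH] ->; rewrite sub_perp imset_f.
  by rewrite sub_perp => wH; exists w => //; rewrite inE wY.
apply: (@point_degree_bound _ (perp x)); rewrite ?cY ?imset_f ?sub_perp //.
- split=> [_ /imsetP[w wY ->]|_ _ /imsetP[v vY ->] /imsetP[w wY ->]].
    by rewrite dim_perp (Ydim _ wY); lia.
  (* Two k-spaces that meet have a proper sum in dimension [2k]; the complement of the sum lies in
     both complements. *)
  have : perp (v + w) != 0%VS.
    rewrite -dimv_eq0 dim_perp -lt0n subn_gt0.
    have := dimv_sum_cap v w; rewrite (Ydim _ vY) (Ydim _ wY).
    have := Yint _ _ vY wY; rewrite -dimv_eq0 -lt0n => h1 h2.
    apply: (@leq_trans (\dim (v + w) + \dim (v :&: w))%N).
      by rewrite -addn1 leq_add2l.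
    by rewrite h2; lia.
  apply: contraNneq => vw; rewrite -subv0 -vw subv_cap.
  by rewrite !perpS ?addvSl ?addvSr.
- by rewrite dim_perp dH; apply/eqP; lia.
Qed.

(** Consecutive [N j] differ by a quotient of two [theta], so the single factor [g = N 3 / (b - 1)]
    makes all three polynomial in [q] and [b]. *)
Lemma gbin_values : exists2 g : rat, 0 < g &
  let b := q ^+ (k - 2) in
  [/\ N 3 = g * (b - 1), N 2 = g * (q ^+ 2 * b ^+ 2 - 1)
    & N 1 = g * (q * b + 1) * (q ^+ 3 * b ^+ 2 - 1)].
Proof.
have q1 := q_gt1 F.
have b1 : 1 < q ^+ (k - 2) by rewrite exprn_egt1 // -lt0n; lia.
exists (N 3 / (q ^+ (k - 2) - 1)).
  by rewrite divr_gt0 ?subr_gt0 // gbin_gt0 //; lia.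
set b := q ^+ (k - 2) in b1 *.
have gS A m : gbin F A m.+1 = theta A / theta m.+1 * gbin F A.-1 m by [].
have q10 := q_sub1_neq0 F.
have b10 : b - 1 != 0 by rewrite subr_eq0 gt_eqF.
have qb10 : q * b - 1 != 0 by rewrite subr_eq0 gt_eqF //; nra.
have thetaE d e : q ^+ d = e -> theta d = (e - 1) / (q - 1) by move=> <-.
have t1 : theta (n - 1) = (q ^+ 3 * b ^+ 2 - 1) / (q - 1).
  by apply: thetaE; rewrite /b -exprM -exprD; congr (_ ^+ _); lia.
have t2 : theta (n - 2) = (q ^+ 2 * b ^+ 2 - 1) / (q - 1).
  by apply: thetaE; rewrite /b -exprM -exprD; congr (_ ^+ _); lia.
have t3 : theta (k - 1) = (q * b - 1) / (q - 1).
  by apply: thetaE; rewrite /b -exprS; congr (_ ^+ _); lia.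
have t4 : theta (k - 2) = (b - 1) / (q - 1) by apply: thetaE.
have e2 : N 2 = theta (n - 2) / theta (k - 2) * N 3.
  have -> : (k - 2 = (k - 3).+1)%N by lia.
  by rewrite gS; congr (_ * gbin _ _ _); lia.
have e1 : N 1 = theta (n - 1) / theta (k - 1) * N 2.
  have -> : (k - 1 = (k - 2).+1)%N by lia.
  by rewrite gS; congr (_ * gbin _ _ _); lia.
have e3 : N 3 = N 3 / (b - 1) * (b - 1) by rewrite divfK.
have e4 : N 2 = N 3 / (b - 1) * (q ^+ 2 * b ^+ 2 - 1).
  by rewrite e2 t2 t4; field; rewrite q10 b10.
split=> //; rewrite e1 e4 t1 t3; field.
by rewrite q10 b10 qb10.
Qed.

Lemma base_powers : (4 <= #|F|)%N ->
  let b := q ^+ (k - 2) in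
  [/\ q ^+ k = q ^+ 2 * b, q ^+ k.-1 = q * b, q ^+ n = (q ^+ 2 * b) ^+ 2,
      q ^+ (n - 2) = (q * b) ^+ 2 & q ^+ (n - 3) = q * b ^+ 2] /\ q <= b.
Proof.
move=> F4 b; rewrite /b; split; last first.
  by rewrite -{1}[q]expr1 ler_weXn2l ?ler1n //; lia.
by split; rewrite -?exprM -?exprD -?exprS -?exprM; congr (_ ^+ _); lia.
Qed.

Lemma intersecting_bound Y : (4 <= #|F|)%N -> intersecting Y ->
  (forall P, point P -> exists2 x, x \in Y & ~~ (P <= x)%VS) ->
  (forall H, \dim H = n.-1 -> exists2 x, x \in Y & ~~ (x <= H)%VS) ->
  #|Y|%:R < 3 * theta k * N 2.
Proof.
move=> F4 iY noP noH; rewrite ltNge; apply/negP => bigY.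
have q4 : 4 <= q by rewrite (ler_nat _ 4).
have degD P : point P -> deg Y P <= D.
  by move=> pP; have [x xY nPx] := noP P pP; apply: point_degree_bound nPx.
have hypD H : \dim H = n.-1 -> #|[set z in Y | (z <= H)%VS]|%:R <= D.
  by move=> dH; have [x xY nxH] := noH H dH; apply: hyperplane_degree_bound nxH.
have [Ydim Yint] := iY; have k_lt_n : (k < n)%N by lia.
have [g g0 [e3 e2 e1]] := gbin_values.
have [[qk qk1 qn qn2 qn3] qb] := base_powers F4.
set b := q ^+ (k - 2) in e3 e2 e1 qk qk1 qn qn2 qn3 qb.
have A16 := A_ge16 q4 qb.
have q0 : 0 < q by lra.
have b0 : 0 < b by lra.
have c0 : 0 < q ^+ 2 * b + 1 by rewrite addr_gt0 // mulr_gt0 // exprn_gt0.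
have tk : theta k = (q ^+ 2 * b - 1) / (q - 1) by rewrite /theta qk.
have c1 : 0 < q ^+ 2 * b - 1 by rewrite expr2 -mulrA; nra.
have meanE : mean_deg k Y = #|Y|%:R / (q ^+ 2 * b + 1).
  rewrite /mean_deg tk /theta qn; move: (#|Y|%:R) => y; field.
  rewrite (_ : _ ^+ 2 - 1 = (q ^+ 2 * b - 1) * (q ^+ 2 * b + 1)); last by ring.
  by rewrite q_sub1_neq0 mulf_neq0 ?(gt_eqF c0) ?(gt_eqF c1).
have y0 : 0 < #|Y|%:R :> rat.
  have N20 : 0 < N 2 by apply: gbin_gt0; lia.
  have tk0 : 0 < theta k by apply: theta_gt0; lia.
  by apply: lt_le_trans bigY; rewrite mulr_gt0 // mulr_gt0.
have bE : (N 2 - N 3) / q ^+ (n - 3) = g * (q ^+ 2 * b - 1) / (q * b).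
  by rewrite qn3 e2 e3; field; rewrite !gt_eqF.
have aE : N 1 - N 2 - g * (q ^+ 2 * b - 1) / (q * b) * q ^+ (n - 2)
          = g * (q ^+ 2 * b - 1) * (q * b) ^+ 2.
  by rewrite qn2 e1 e2; field; rewrite !gt_eqF.
have s_lt : mean_deg k Y * theta k < #|Y|%:R.
  rewrite meanE tk; have /andP[h1 h2] := mean_share_lt q4 qb y0.
  exact: le_lt_trans h1 h2.
have b_ge0 : 0 <= g * (q ^+ 2 * b - 1) / (q * b).
  by rewrite divr_ge0 ?mulr_ge0 ?(ltW g0) ?(ltW c1) ?(ltW q0) ?(ltW b0).
have a_ge0 : 0 <= g * (q ^+ 2 * b - 1) * (q * b) ^+ 2.
  by rewrite mulr_ge0 ?sqr_ge0 // mulr_ge0 ?(ltW g0) ?(ltW c1).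
have := third_moment_bound Ydim Yint k_ge3 k_lt_n (esym bE) (esym aE)
          b_ge0 a_ge0 (erefl _) y0 s_lt degD hypD.
rewrite meanE tk e3 e2 e1 qk1 qn2; move: bigY; rewrite tk e2.
move: (#|Y|%:R) => y bigy ineq.
apply: (moment_contradiction q4 qb g0 bigy); move: ineq.
congr (_ <= _ * _ + _ * _).
- by ring.
(* The point and hyperplane contributions have equal coefficients, whence the factor 2. *)
- by field; rewrite !gt_eqF.
Qed.

End Bound.

(** * The cases [k = 1] and [k = 2] *)

Section SmallDimension.

Variable F : finFieldType.
Local Notation point P := (\dim P == 1%N).

Lemma span_points n (P Q w : {vspace 'rV[F]_n}) : point P -> point Q -> P != Q ->
  (P <= w)%VS -> (Q <= w)%VS -> \dim w = 2%N -> w = (P + Q)%VS.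
Proof.
move=> pP pQ PQ Pw Qw dw; apply/esym/eqP; rewrite eqEdim subv_add Pw Qw dw /=.
rewrite dim_add_point ?(eqP pP) ?(eqP pQ) //.
by apply: contraNN PQ => QP; rewrite (point_le_point pQ pP QP).
Qed.

(** Points that meet coincide, so any member serves; for an empty family any point does. *)
Lemma intersecting_points (Y : {set {vspace 'rV[F]_(2 * 1)}}) : intersecting Y ->
  exists2 P : {vspace 'rV[F]_(2 * 1)}, point P & forall x, x \in Y -> (P <= x)%VS.
Proof.
move=> [Ydim Yint].
have [-> | [x xY]] := set_0Vmem Y; last first.
  exists x => [|z zY]; first by rewrite (Ydim _ xY).
  by apply: cap_neq0_point (Yint _ _ zY xY); rewrite (Ydim _ xY).
have [|P pP _] := @exists_point F (2 * 1) fullv.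
  by rewrite -dimv_eq0 dimvf.
by exists P => // x; rewrite inE.
Qed.

(** Two members [u], [v] through one point would force all of [Y] into the hyperplane [u + v]. So
    degrees are at most 1, and since every member meets a fixed [x], there are at most [theta F 2]
    members. *)
Lemma intersecting_lines (Y : {set {vspace 'rV[F]_(2 * 2)}}) : intersecting Y ->
  (forall P, point P -> exists2 x, x \in Y & ~~ (P <= x)%VS) ->
  (forall H, \dim H = (2 * 2).-1%N -> exists2 x, x \in Y & ~~ (x <= H)%VS) ->
  #|Y|%:R < 3 * theta F 2.
Proof.
move=> [Ydim Yint] noP noH.
have deg1 P : point P -> deg Y P <= 1.
  move=> pP; rewrite /deg (ler_nat _ _ 1); apply/card_le1_eqP => u v.
  rewrite !inE => /andP[uY Pu] /andP[vY Pv]; apply/eqP/negPn/negP => uv.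
  have [dv du] := (Ydim _ vY, Ydim _ uY).
  have cap_uv Q : point Q -> (Q <= u)%VS -> (Q <= v)%VS -> Q = P.
    move=> pQ Qu Qv; apply/eqP; apply: contraNT uv => QP; apply/eqP.
    by rewrite (span_points pQ pP QP Qu Pu du) (span_points pQ pP QP Qv Pv dv).
  (* Such a [w] meets [u] and [v] in distinct points, which span it. *)
  have inH w : w \in Y -> ~~ (P <= w)%VS -> (w <= u + v)%VS.
    move=> wY nPw.
    have [Q pQ] := exists_point (Yint _ _ wY uY); rewrite subv_cap => /andP[Qw Qu].
    have [R pR] := exists_point (Yint _ _ wY vY); rewrite subv_cap => /andP[Rw Rv].
    have QR : Q != R.
      apply: contraNneq nPw => QR; rewrite -(cap_uv Q) // QR //.
    rewrite (span_points pQ pR QR Qw Rw (Ydim _ wY)) subv_add.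
    by rewrite (subv_trans Qu (addvSl _ _)) (subv_trans Rv (addvSr _ _)).
  have duv : \dim (u + v) = (2 * 2).-1%N.
    have cap1 : (u :&: v)%VS = P.
      apply/esym/eqP; rewrite eqEdim subv_cap Pu Pv (eqP pP) /=.
      have /leqifP := dimv_leqif_eq (capvSl u v); rewrite du; case: eqP => // /capv_idPl uv'.
      by case/negP: uv; rewrite eq_sym eqEdim uv' du dv.
    by have := dimv_sum_cap u v; rewrite cap1 du dv (eqP pP) addn1 => -[].
  (* A member through [P] is spanned by [P] and a point of [x], where [x] misses [P] and so lies in
     [u + v]. *)
  have [x xY nPx] := noP P pP; have [w wY /negP[]] := noH _ duv.
  have [Pw|/inH->//] := boolP (P <= w)%VS.
  have [Q pQ] := exists_point (Yint _ _ wY xY); rewrite subv_cap => /andP[Qw Qx].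
  have PQ : P != Q by apply: contraNneq nPx => ->.
  rewrite (span_points pP pQ PQ Pw Qw (Ydim _ wY)) subv_add.
  by rewrite (subv_trans Pu (addvSl _ _)) (subv_trans Qx (inH _ xY nPx)).
have [|P0 pP0 _] := @exists_point F (2 * 2) fullv.
  by rewrite -dimv_eq0 dimvf.
have [x xY _] := noP _ pP0.
have t2 : 0 < theta F 2 by apply: theta_gt0.
apply: (@le_lt_trans _ _ (theta F 2)); last by lra.
have tx := count_points x; rewrite (Ydim _ xY) in tx; rewrite -tx.
apply: (@le_trans _ _ (\sum_(Q | point Q && (Q <= x)%VS) deg Y Q)).
  apply: (card_le_cover (f := id)) => // z zY.
  have [Q pQ] := exists_point (Yint _ _ xY zY); rewrite subv_cap => /andP[Qx Qz].
  by exists Q; rewrite ?pQ.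
by apply: ler_sum => Q /andP[pQ _]; apply: deg1.
Qed.

End SmallDimension.

(** * Comparison of Gaussian binomials, and assembly of the theorem *)

(** The recurrence pairs numerators with denominators in the opposite order to [gauss_binom], so the
    two products are kept apart; the factors [q - 1] cancel. *)
Lemma gbinE (F : finFieldType) N m (q := #|F|%:R : rat) :
  gbin F N m = \prod_(i < m) (q ^+ (N - i) - 1) / \prod_(i < m) (q ^+ i.+1 - 1).
Proof.
elim: m N => [|m IH] N; first by rewrite !big_ord0 divr1.
rewrite big_ord_recl big_ord_recr /= IH subn0 /theta.
under [in RHS]eq_bigr => i _ do rewrite /bump /= add1n subnS predn_sub.
have q1 : q - 1 != 0 by apply: q_sub1_neq0.
have cancel_q1 (x y : rat) : x / (q - 1) / (y / (q - 1)) = x / y.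
  by rewrite invf_div mulrA divfK.
by rewrite cancel_q1 mulf_div [X in _ / X]mulrC.
Qed.

Lemma gauss_binom_gbin (F : finFieldType) N m : (m <= N)%N ->
  gauss_binom #|F| N%:Z m%:Z = gbin F N m.
Proof.
move=> mN; rewrite gbinE -prodf_div /= big_add1 big_mkord.
apply: eq_bigr => i _; congr ((_ - 1) / _).
have -> : (N%:Z - i.+1%:Z + 1 = (N - i)%N%:Z)%R by have := ltn_ord i; lia.
by rewrite -exprnP.
Qed.

Theorem theorem6 (q : nat) (F : finFieldType) (k : nat)
    (hF : #|F| = q) (hq : (4 <= q)%N) (hk : (1 <= k)%N)
    (Y : {set qK_vertex F k})
    (hY : independent (@qK_adj F k) Y)
    (hD : forall D : {set qK_vertex F k}, is_dictator D -> ~~ (Y \subset D))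
    (hD' : forall D : {set qK_vertex F k},
        is_dual_dictator D -> ~~ (Y \subset D)) :
  (#|Y|%:R : rat) <
    3%:R * gauss_binom q k%:Z 1 * gauss_binom q (2 * k%:Z - 2) (k%:Z - 2).
Proof.
subst q; pose Z : {set {vspace 'rV[F]_(2 * k)}} := val @: Y.
have cZ : #|Z| = #|Y| by apply: card_imset; apply: val_inj.
have iZ : intersecting Z.
  split=> [_ /imsetP[U _ ->]|_ _ /imsetP[U UY ->] /imsetP[W WY ->]].
    exact/eqP/(valP U).
  exact: hY UY WY.
have noP P : \dim P == 1%N -> exists2 x, x \in Z & ~~ (P <= x)%VS.
  move=> /eqP dP.
  have /hD/subsetPn[U UY] : is_dictator (@dictator F k P) by exists P.
  by rewrite inE => nPU; exists (val U); rewrite ?imset_f.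
have noH H : \dim H = (2 * k).-1%N -> exists2 x, x \in Z & ~~ (x <= H)%VS.
  rewrite -subn1 => dH.
  have /hD'/subsetPn[U UY] : is_dual_dictator (@dual_dictator F k H) by exists H.
  by rewrite inE => nUH; exists (val U); rewrite ?imset_f.
have -> : gauss_binom #|F| k%:Z 1 = theta F k.
  by rewrite (@gauss_binom_gbin F k 1) //= theta1 divr1 mulr1.
rewrite -cZ; case: k hk Y hY hD hD' Z cZ iZ noP noH => [//|[|k]] _ Y hY hD hD' Z _ iZ noP noH.
  (* For [k = 1] the bound is zero, and the common point contradicts [noP]. *)
  have [P pP PZ] := intersecting_points iZ.
  by have [x xZ /negP[]] := noP P pP; apply: PZ.
have -> : gauss_binom #|F| (2 * k.+2%:Z - 2) (k.+2%:Z - 2) = gbin F (2 * k.+2 - 2) (k.+2 - 2).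
  by rewrite -gauss_binom_gbin; [congr gauss_binom; lia | lia].
case: k Y hY hD hD' Z iZ noP noH => [|k] Y hY hD hD' Z iZ noP noH.
  (* For [k = 2] the last factor is [gbin F 2 0 = 1]. *)
  by rewrite mulr1; apply: intersecting_lines.
exact: intersecting_bound.
Qed.
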